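(* Let $(\Omega,\mathcal A,\mu,d)$ be a metric measure space equipped with a doubling Borel probability measure $\mu$. Let $\{B_i\}_{i\in\mathbb N}$ be a sequence of balls in $\Omega$ and suppose that there exist constants $a,b>1$ such that $\mu(aB_i)\le b\,\mu(B_i)$ for all sufficiently large $i$. Let $E_\infty:=\limsup_{i\to\infty}B_i=\bigcap_{t=1}^\infty\bigcup_{i=t}^\infty B_i$. Then $$\mu(E_\infty)>0$$ if and only if there exist a subsequence $\{L_i\}_{i\in\mathbb N}$ of $\{B_i\}_{i\in\mathbb N}$ and a constant $C>0$ such that $$\sum_{i=1}^\infty\mu(L_i)=\infty$$ and, for infinitely many $Q\in\mathbb N$, $$\sum_{s,t=1}^Q\mu(L_s\cap L_t)\le C\left(\sum_{s=1}^Q\mu(L_s)\right)^2 .$$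
   Context: $(\Omega,d)$ is a metric space, $\mathcal A$ is a $\sigma$-algebra on $\Omega$ containing all Borel sets, and $\mu$ is a probability measure on $\mathcal A$. $\operatorname{supp}\mu$ denotes the support of $\mu$, i.e. the smallest closed set of full $\mu$-measure. For $x\in\Omega$ and $r>0$, $B(x,r)=\{y\in\Omega: d(x,y)<r\}$ is the ball centred at $x$ of radius $r$; a ball $B=B(x,r)$ always comes with a prescribed centre $x$ and radius $r$, and for $a>0$ we write $aB:=B(x,ar)$. The measure $\mu$ is doubling if there are constants $\lambda\ge1$ and $r_0>0$ such that $\mu(B(x,2r))\le\lambda\,\mu(B(x,r))$ for all $x\in\operatorname{supp}\mu$ and $0<r<r_0$. *)

(* Defs.v *)
From HB Require Import structures.
From mathcomp Require Import all_boot all_order all_algebra.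
From mathcomp Require Import all_classical all_reals all_analysis.

Set Implicit Arguments.
Unset Strict Implicit.
Unset Printing Implicit Defensive.

Import Order.TTheory GRing.Theory Num.Theory.

Local Open Scope classical_set_scope.
Local Open Scope ring_scope.
Local Open Scope ereal_scope.

(* A metric space together with a sigma-algebra; no relation between the two
   is built in, see borel_in_measurable. *)
#[short(type="metricMeasurableType")]
HB.structure Definition MetricMeasurable (R : numDomainType)
    (d : measure_display) :=
  { T of Metric R T & Measurable d T }.

Definition borel_in_measurable (R : realType) (d : measure_display)
    (T : metricMeasurableType R d) : Prop :=
  <<s (open : set (set T)) >> `<=` measurable.

Definition is_support (R : realType) (d : measure_display)
    (T : metricMeasurableType R d) (mu : probability T R) (S : set T) : Prop :=
  [/\ closed S, mu S = 1 &
      forall F : set T, closed F -> mu F = 1 -> S `<=` F].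

(* A smallest closed set of full measure is unique when it exists, but on a
   non-separable space its existence is not automatic; it is part of what it
   means for mu to be doubling, since the condition refers to it. *)
Definition doubling (R : realType) (d : measure_display)
    (T : metricMeasurableType R d) (mu : probability T R) : Prop :=
  exists2 S : set T, is_support mu S &
    exists lambda r0 : R,
      [/\ (1 <= lambda)%R, (0 < r0)%R &
          forall (x : T) (r : R), S x -> (0 < r < r0)%R ->
            mu (ball x (2 * r)%R) <= lambda%:E * mu (ball x r)].

(* Main.v *)
Require Import Defs.
From mathcomp Require Import all_boot all_order all_algebra.
From mathcomp Require Import all_classical all_reals all_analysis.
From mathcomp Require Import measurable_realfun ring lra.

Import Order.TTheory GRing.Theory Num.Theory.

Local Open Scope classical_set_scope.
Local Open Scope ring_scope.
Local Open Scope ereal_scope.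

(* If the sums diverge and the L_s are quasi-independent on average, the second
   moment method bounds mu(U_{s >= N} L_s) below by 1 / (4 C) for every N.

   Conversely, let mu(E) > 0.  There is kappa > 0 such that beyond every index t
   one finds finitely many pairwise disjoint balls B_i of total measure at least
   kappa: a single ball if mu(B_i) does not tend to 0; otherwise every point of
   E in the support lies, for large i, only in balls B_i of small radius,
   because mu(a B_i) <= b mu(B_i) bounds mu(B_i) below when r_i is not small,
   and Vitali's covering lemma applies, since the doubling property transfers
   from balls centred in the support to those meeting it.  Concatenate
   such blocks.  Each block has measure between kappa and 1, so after n
   blocks the double sum is at most n^2 and the simple sum at least n kappa:
   C = kappa^-2 works for these Q, whatever the correlations between blocks. *)

(** * Infinite sets of indices and concatenation of finite blocks *)

Lemma infinite_set_natP (A : set nat) :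
  infinite_set A <-> forall N, exists2 Q, (N <= Q)%N & A Q.
Proof.
split=> [infA N|unbA /finite_seqP[s As]].
  have /infinite_setN0[Q [AQ /= NQ]] := infinite_setD infA (finite_II N).
  by exists Q => //; rewrite leqNgt; apply/negP.
have [Q ltQ] := unbA (\max_(i <- s) i).+1.
rewrite As /= => Qs; move: ltQ.
by rewrite ltnNge => /negP; apply; exact: (@leq_bigmax_seq nat s xpredT (fun i => i)).
Qed.

(** Blocks are chosen recursively, each beyond the last index of the preceding ones, and [phi]
    enumerates their concatenation. The last clause makes sums over an initial segment of [phi]
    split into sums over blocks; nonempty blocks make these segments arbitrarily long. *)
Lemma subseq_of_blocks (P : seq nat -> Prop) :
  (forall t, exists s, [/\ sorted ltn s, all (leq t) s, s != [::] & P s]) ->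
  exists (phi : nat -> nat) (blk : nat -> seq nat),
    [/\ {homo phi : i j / (i < j)%N}, forall n, P (blk n),
        forall n, (n <= size (flatten (mkseq blk n)))%N &
        forall n, mkseq phi (size (flatten (mkseq blk n)))
                  = flatten (mkseq blk n)].
Proof.
move=> /choice[g gP].
(* On the empty prefix the default 0 only forces the first block to start at index 1 or later. *)
pose next (s : seq nat) := g (last 0%N s).+1.
pose pre n := iter n (fun s => s ++ next s) [::].
pose blk n := next (pre n).
have preE n : flatten (mkseq blk n) = pre n.
  elim: n => // n IH.
  by rewrite mkseqS -cats1 flatten_cat IH /= cats0.
have size_pre n : (n <= size (pre n))%N.
  elim: n => // n IH; rewrite /= size_cat -addn1 leq_add// lt0n size_eq0.
  by rewrite /next; have [] := gP (last 0%N (pre n)).+1.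
have sorted_pre n : sorted ltn (pre n).
  elim: n => // n IH /=.
  have [sg /allP ag _ _] := gP (last 0%N (pre n)).+1.
  rewrite (sorted_pairwise ltn_trans) pairwise_cat.
  rewrite -!(sorted_pairwise ltn_trans) IH sg !andbT.
  apply/allrelP => x y xpre /ag; apply: leq_trans.
  rewrite ltnS; move: IH xpre; case/lastP: (pre n) => // s z.
  rewrite (sorted_pairwise ltn_trans).
  rewrite last_rcons pairwise_rcons mem_rcons inE => /andP[/allP sz _].
  by case/predU1P => [->//|/sz /ltnW].
have nth_pre m n i : (m <= n)%N -> (i < size (pre m))%N ->
    nth 0%N (pre n) i = nth 0%N (pre m) i.
  move=> /subnKC <- im; elim: (n - m)%N => [|k IH]; first by rewrite addn0.
  rewrite addnS /= nth_cat IH ifT//.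
  elim: k {IH} => [|k IH]; first by rewrite addn0.
  by rewrite addnS /= size_cat (leq_trans IH)// leq_addr.
(* The first [i.+1] blocks have at least [i.+1] entries, so the default is never read; by [nth_pre]
   any longer prefix gives the same value. *)
pose phi i := nth 0%N (pre i.+1) i.
exists phi, blk; split.
- move=> i j ij; rewrite /phi -(nth_pre i.+1 j.+1 i) ?size_pre//; last exact: ltnW.
  apply: (sorted_ltn_nth ltn_trans) => //; rewrite inE ?size_pre//.
  by rewrite (leq_trans ij)// (leq_trans _ (size_pre j.+1)).
- by move=> n; have [] := gP (last 0%N (pre n)).+1.
- by move=> n; rewrite preE.
- move=> n; rewrite preE; apply: (@eq_from_nth _ 0%N); rewrite size_mkseq// => i ilt.
  rewrite nth_mkseq// /phi; have [le|/ltnW le] := leqP n i.+1.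
    exact: nth_pre.
  by rewrite -(nth_pre i.+1 n)// size_pre.
Qed.

(** * Vitali's covering lemma for finitely many balls *)

(** Greedy selection: keep a ball [k] of largest radius, discard every ball meeting it, and recurse
    on those disjoint from it. A discarded ball lies in the triple of ball [k], its radius being at
    most [r k]. *)
Lemma vitali_finite (R : realType) (M : metricType R) (I : eqType)
    (c : I -> M) (r : I -> R) (s : seq I) :
  (forall i, 0 < r i)%R ->
  exists D : seq I, [/\ uniq D, {subset D <= s},
    trivIset [set` D] (fun i => ball (c i) (r i)) &
    forall i, i \in s -> exists2 j, j \in D &
      ball (c i) (r i) `<=` ball (c j) (3 * r j)%R].
Proof.
move=> r_gt0; have [n] := ubnP (size s); elim: n s => // n IH s.
have [->|s0] := eqVneq s [::]; first by exists [::]; split=> // i [].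
rewrite ltnS => sn.
have [k ks kmax] : exists2 k, k \in s & forall i, i \in s -> (r i <= r k)%R.
  case: s s0 {sn IH} => // x s _; elim: s x => [|y s IH] x.
    by exists x; rewrite ?inE// => i; rewrite inE => /eqP ->.
  have [k ks kmax] := IH y.
  have [xk|/ltW kx] := leP (r x) (r k).
    exists k; first by rewrite inE ks orbT.
    by move=> i; rewrite inE => /predU1P[->|/kmax].
  exists x; first by rewrite inE eqxx.
  by move=> i; rewrite inE => /predU1P[->|/kmax ik]//; exact: le_trans kx.
pose far i := `[< ball (c i) (r i) `&` ball (c k) (r k) = set0 >].
have kfar : ~~ far k.
  apply/asboolPn; rewrite setIid => /seteqP[/(_ (c k)) + _].
  by apply; exact: ballxx.
have [|D [uD Ds tD cD]] := IH [seq i <- s | far i].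
  (* The filtered list is strictly shorter, because ball [k] is nonempty and so [k] is not far from
     itself. *)
  rewrite size_filter (leq_trans _ sn)// -(count_predC far s) -addn1 leq_add2l.
  by rewrite -has_count; apply/hasP; exists k.
have Dfar i : i \in D -> far i by move=> /Ds; rewrite mem_filter => /andP[].
exists (k :: D); split.
- by rewrite /= uD andbT; apply/negP => /Dfar; apply/negP.
- move=> i; rewrite inE => /predU1P[->//|/Ds].
  by rewrite mem_filter => /andP[].
- move=> i j /=; rewrite !inE => /predU1P[->|iD] /predU1P[->|jD] //.
  + by move/Dfar: jD => /asboolP; rewrite setIC => -> /set0P; rewrite eqxx.
  + by move/Dfar: iD => /asboolP -> /set0P; rewrite eqxx.
  + exact: tD.
- move=> i si; case/boolP: (far i) => fi.
    have [|j jD ij] := cD i; first by rewrite mem_filter fi.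
    by exists j; rewrite ?inE ?jD ?orbT.
  exists k; rewrite ?inE ?eqxx// => y.
  have /eqP/set0P[z []] := asboolPn _ fi.
  rewrite !ballEmdist /= => iz kz iy.
  rewrite (le_lt_trans (metric_triangle _ z _))//.
  rewrite (_ : 3 * r k = r k + (r k + r k))%R; last by lra.
  rewrite ltrD// (le_lt_trans (metric_triangle _ (c i) _))// ltrD//.
    by rewrite metric_sym (lt_le_trans iz)// kmax.
  by rewrite (lt_le_trans iy)// kmax.
Qed.

(** * Measure inequalities for finite families of sets *)

Section measure_inequalities.
Context {R : realType} {d : measure_display} {T : measurableType d}.

(** A general [A] lets the induction run: by disjointness the remaining terms do not change when [A]
    shrinks to its part outside [B x]. It also controls the correlations of a disjoint block with
    any fixed set. *)
Lemma sum_trivIset_le (mu : measure T R) (I : eqType) (B : I -> set T)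
    (s : seq I) (A : set T) :
  (forall i, measurable (B i)) -> measurable A -> uniq s ->
  trivIset [set` s] B -> \sum_(i <- s) mu (B i `&` A) <= mu A.
Proof.
move=> mB + us tB; elim: s us tB A => [_ _ A _|x s IH /= /andP[xs us] tB A mA].
  by rewrite big_nil.
rewrite big_cons.
have -> : \sum_(i <- s) mu (B i `&` A) =
    \sum_(i <- s) mu (B i `&` (A `\` B x)).
  apply: eq_big_seq => i si; congr (mu _).
  rewrite setIDA; apply/esym/setDidl.
  have ix : i != x by apply: contraNneq xs => <-.
  rewrite setIAC (trivIsetP.1 tB i x) ?set0I//= inE ?si ?eqxx ?orbT//.
have mAB : measurable (A `\` B x) by exact: measurableD.
apply: (@le_trans _ _ (mu (B x `&` A) + mu (A `\` B x))).
  apply: leeD2l; apply: IH => //.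
  by apply: sub_trivIset tB => i /= si; rewrite inE si orbT.
rewrite setIC -measureU ?setUIDK//; first exact: measurableI.
by rewrite -setIA setDIK setI0.
Qed.

(* Integrate [2 l f <= f^2 + l^2 1_U] for the counting function [f] of the
   family, which vanishes outside [U]. *)
Lemma second_moment_bound (mu : measure T R) (I : eqType) (A : I -> set T)
    (U : set T) (s : seq I) (l : R) :
  (forall i, measurable (A i)) -> measurable U ->
  (forall i, i \in s -> A i `<=` U) -> (0 <= l)%R ->
  (2 * l)%:E * \sum_(i <- s) mu (A i) <=
  \sum_(i <- s) \sum_(j <- s) mu (A i `&` A j) + (l ^+ 2)%:E * mu U.
Proof.
move=> mA mU AU l0.
have mI (B : set T) : measurable B ->
    measurable_fun [set: T] (EFin \o (\1_B : T -> R)).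
  by move=> mB; apply/measurable_EFinP; exact: measurable_indic.
have I0 (B : set T) x : 0 <= (\1_B x : R)%:E by rewrite lee_fin.
have intI (B : set T) : measurable B -> \int[mu]_x (\1_B x : R)%:E = mu B.
  by move=> mB; rewrite integral_indic// setIT.
have mAA i j : measurable (A i `&` A j) by exact: measurableI.
have mS1 : measurable_fun [set: T] (fun x => \sum_(i <- s) (\1_(A i) x : R)%:E : \bar R).
  by apply: emeasurable_sum => i; exact: mI.
have mS2 i :
    measurable_fun [set: T] (fun x => \sum_(j <- s) (\1_(A i `&` A j) x : R)%:E : \bar R).
  by apply: emeasurable_sum => j; exact: mI.
have -> : \sum_(i <- s) mu (A i) =
    \int[mu]_x \sum_(i <- s) (\1_(A i) x : R)%:E.
  rewrite ge0_integral_sum//; last by move=> i; exact: mI.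
  by apply: eq_bigr => i _; rewrite intI.
have -> : \sum_(i <- s) \sum_(j <- s) mu (A i `&` A j) =
    \int[mu]_x \sum_(i <- s) \sum_(j <- s) (\1_(A i `&` A j) x : R)%:E.
  rewrite ge0_integral_sum//; last by move=> i x _; exact: sume_ge0.
  apply: eq_bigr => i _; rewrite ge0_integral_sum//; last by move=> j; exact: mI.
  by apply: eq_bigr => j _; rewrite intI.
rewrite -(intI U)// -!ge0_integralZl//=; first last.
- by rewrite lee_fin mulr_ge0.
- by move=> x _; exact: sume_ge0.
- by rewrite lee_fin sqr_ge0.
- exact: mI.
rewrite -ge0_integralD//=; first last.
- by apply: measurable_funeM; exact: mI.
- by move=> x _; rewrite mule_ge0// lee_fin sqr_ge0.
- by apply: emeasurable_sum => i; exact: mS2.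
- by move=> x _; apply: sume_ge0 => i _; exact: sume_ge0.
apply: ge0_le_integral => //.
- by move=> x _; rewrite mule_ge0 ?lee_fin ?mulr_ge0//; exact: sume_ge0.
- exact: measurable_funeM.
- apply: emeasurable_funD; first by apply: emeasurable_sum => i; exact: mS2.
  by apply: measurable_funeM; exact: mI.
move=> x _.
under [X in _ <= X + _]eq_bigr => i _ do rewrite sumEFin.
rewrite !sumEFin -!EFinM -EFinD lee_fin.
(* The indicator of an intersection is a product, so the double sum is the square of [f]. *)
under [X in (_ <= X + _)%R]eq_bigr => i _.
  under eq_bigr => j _ do rewrite indicI.
  rewrite -mulr_sumr; over.
rewrite -mulr_suml; set f := (\sum_(i <- s) _)%R.
have [Ux|nUx] := pselect (U x).
  by rewrite indicE mem_set//= mulr1; have := sqr_ge0 (f - l); nra.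
suff -> : f = 0%R by rewrite !mul0r mulr0 add0r mulr_ge0 ?sqr_ge0.
rewrite /f big_seq big1// => i /AU AiU; rewrite indicE memNset//.
by move/AiU.
Qed.

End measure_inequalities.

(** * From quasi-independence to a limsup set of positive measure *)

(** The measure of the limsup set is the limit of the measures of the tail unions, so it suffices to
    bound each tail union below, by the second moment bound for the sets with index in [[N, Q)]. *)
Lemma lim_sup_set_quasi_independent (R : realType) (d : measure_display)
    (T : measurableType d) (mu : probability T R) (A : nat -> set T) (C : R) :
  (forall i, measurable (A i)) -> (0 < C)%R ->
  \sum_(0 <= i <oo) mu (A i) = +oo ->
  infinite_set [set Q : nat |
    \sum_(0 <= s < Q) \sum_(0 <= t < Q) mu (A s `&` A t)
      <= C%:E * (\sum_(0 <= s < Q) mu (A s)) ^+ 2] ->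
  (4 * C)^-1%:E <= mu (lim_sup_set A).
Proof.
move=> mA C0 Aoo /infinite_set_natP infQ.
have mU N : measurable (\bigcup_(k in [set k | (N <= k)%N]) A k).
  exact: bigcup_measurable.
have Acvg := @lim_sup_set_cvg _ _ _ mu A mA
  (le_lt_trans (probability_le1 mu (mU 0%N)) (ltry 1%R)).
rewrite -(cvg_lim (@ereal_hausdorff _) Acvg).
apply: lime_ge; first by apply/cvg_ex; exists (mu (lim_sup_set A)).
apply: nearW => N.
pose m i := fine (mu (A i)).
pose w i j := fine (mu (A i `&` A j)).
have mE i : mu (A i) = (m i)%:E by rewrite fineK// fin_num_measure.
have wE i j : mu (A i `&` A j) = (w i j)%:E.
  by rewrite fineK// fin_num_measure//; exact: measurableI.
have m0 i : (0 <= m i)%R by exact: fine_ge0.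
have w0 i j : (0 <= w i j)%R by exact: fine_ge0.
pose S n := (\sum_(0 <= i < n) m i)%R.
have sumE k n : \sum_(k <= i < n) mu (A i) = (\sum_(k <= i < n) m i)%:E.
  by rewrite -sumEFin; apply: eq_bigr.
have sumwE k n : \sum_(k <= i < n) \sum_(k <= j < n) mu (A i `&` A j) =
    (\sum_(k <= i < n) \sum_(k <= j < n) w i j)%:E.
  rewrite -sumEFin; apply: eq_bigr => i _; rewrite -sumEFin.
  by apply: eq_bigr => j _; exact: wE.
(* Beyond this threshold the sum from [N] on is more than half of [S Q], and [S Q] is positive. *)
have [M MP] : exists M : nat, forall n, (M <= n)%N -> (2 * S N + 1 < S n)%R.
  have := @is_cvg_nneseries R (fun i => mu (A i)) xpredT 0%N
    (fun n _ _ => measure_ge0 mu (A n)).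
  rewrite Aoo => /cvgeyPgt/(_ (2 * S N + 1)%R)[M _ MP]; exists M => n Mn.
  by have := MP n Mn; rewrite /= sumE lte_fin.
have [Q NMQ /=] := infQ (maxn N M).
move: NMQ; rewrite geq_max => /andP[NQ MQ].
rewrite sumwE sumE. rewrite -!EFinM lee_fin -expr2 => quasi.
have SQ := MP Q MQ.
have S0 n : (0 <= S n)%R by exact: sumr_ge0.
have splitS : (S Q = S N + \sum_(N <= i < Q) m i)%R by rewrite -big_cat_nat.
have AU i : i \in index_iota N Q ->
    A i `<=` \bigcup_(k in [set k | (N <= k)%N]) A k.
  by rewrite mem_index_iota => /andP[Ni _] x Aix; exists i.
have CS0 : (0 <= 2 * C * S Q)%R by rewrite !mulr_ge0// ltW.
rewrite -[leRHS]fineK ?fin_num_measure// lee_fin; set u := fine _.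
set W := (\sum_(N <= i < Q) \sum_(N <= j < Q) w i j)%R.
(* With [S Q / 2] below the tail sum and [C * S Q ^+ 2] above [W], the value [l = 2 * C * S Q]
   yields the best lower bound for [u]. *)
have bound : (2 * (2 * C * S Q) * \sum_(N <= i < Q) m i <=
    W + (2 * C * S Q) ^+ 2 * u)%R.
  rewrite -lee_fin EFinD (EFinM (_ ^+ 2)) (EFinM _ (\sum_(_ <= _ < _) _)).
  rewrite -sumE -sumwE fineK ?fin_num_measure//.
  exact: second_moment_bound.
have WQ : (W <= C * S Q ^+ 2)%R.
  apply: le_trans quasi; rewrite /W (@big_cat_nat _ _ _ N 0%N Q)//=.
  rewrite -[leLHS]add0r lerD//.
    by apply: sumr_ge0 => i _; exact: sumr_ge0.
  apply: ler_sum => i _; rewrite [leRHS](@big_cat_nat _ _ _ N 0%N Q)//=.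
  by rewrite lerDr sumr_ge0.
have SQ0 : (0 < S Q)%R by have := S0 N; lra.
have : (2 * C * S Q ^+ 2 <= C * S Q ^+ 2 + 4 * C ^+ 2 * S Q ^+ 2 * u)%R.
  apply: (@le_trans _ _ (2 * (2 * C * S Q) * \sum_(N <= i < Q) m i)%R).
    have -> : (2 * C * S Q ^+ 2 = 2 * (2 * C * S Q) * (S Q / 2))%R by field.
    by rewrite ler_pM2l ?mulr_gt0//; have := S0 N; lra.
  apply: (le_trans bound); apply: lerD => //.
  by rewrite le_eqVlt; apply/orP; left; apply/eqP; ring.
have -> : (2 * C * S Q ^+ 2 = C * S Q ^+ 2 * 2)%R by ring.
have -> : (C * S Q ^+ 2 + 4 * C ^+ 2 * S Q ^+ 2 * u =
           C * S Q ^+ 2 * (1 + u * (4 * C)))%R by ring.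
rewrite ler_pM2l ?mulr_gt0 ?exprn_gt0// => ?.
rewrite -[leLHS]mul1r ler_pdivrMr ?mulr_gt0//; lra.
Qed.

(** * From disjoint blocks to quasi-independence on average *)

Lemma quasi_independent_of_disjoint_blocks (R : realType) (d : measure_display)
    (T : measurableType d) (mu : probability T R) (B : nat -> set T)
    (kappa : R) :
  (forall i, measurable (B i)) -> (0 < kappa)%R ->
  (forall t, exists s : seq nat, [/\ uniq s, all (leq t) s,
    trivIset [set` s] B & kappa%:E <= \sum_(i <- s) mu (B i)]) ->
  exists (phi : nat -> nat) (C : R),
    [/\ {homo phi : i j / (i < j)%N}, (0 < C)%R,
        \sum_(0 <= i <oo) mu (B (phi i)) = +oo &
        infinite_set [set Q : nat |
          \sum_(0 <= s < Q) \sum_(0 <= t < Q) mu (B (phi s) `&` B (phi t))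
            <= C%:E * (\sum_(0 <= s < Q) mu (B (phi s))) ^+ 2]].
Proof.
move=> mB k0 blocks.
pose P s := [/\ uniq s, trivIset [set` s] B &
  kappa%:E <= \sum_(i <- s) mu (B i)].
have [|phi [blk [phi_mono blkP leQ phiE]]] := @subseq_of_blocks P.
  move=> t; have [s [us ts tB ks]] := blocks t.
  have sumE : \sum_(i <- sort leq s) mu (B i) = \sum_(i <- s) mu (B i).
    by apply: perm_big; rewrite perm_sort.
  (* Sorting affects neither the sum nor disjointness; the block is nonempty since an empty sum is
     below [kappa]. *)
  exists (sort leq s); split.
  - by rewrite ltn_sorted_uniq_leq sort_uniq us sort_sorted//; exact: leq_total.
  - by rewrite all_sort.
  - apply: contraTneq ks => s0; rewrite -sumE s0 big_nil -ltNge lte_fin//.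
  - split; rewrite ?sort_uniq ?sumE//.
    by apply: sub_trivIset tB => i /=; rewrite mem_sort.
pose Q n := size (flatten (mkseq blk n)).
have sum_phi (F : nat -> \bar R) n :
    \sum_(0 <= i < Q n) F (phi i) = \sum_(0 <= k < n) \sum_(i <- blk k) F i.
  have -> : \sum_(0 <= i < Q n) F (phi i) = \sum_(i <- mkseq phi (Q n)) F i.
    by rewrite /mkseq big_map /index_iota subn0.
  by rewrite phiE big_flatten big_map /index_iota subn0.
have sumk n : (kappa * n%:R)%:E <= \sum_(0 <= i < Q n) mu (B (phi i)).
  rewrite (sum_phi (mu \o B)); elim: n => [|n IH].
    by rewrite mulr0 big_geq.
  rewrite big_nat_recr//= -natr1 mulrDr mulr1 EFinD leeD//.
  by have [] := blkP n.
have le1 A n : measurable A -> \sum_(i <- blk n) mu (B i `&` A) <= mu A.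
  by move=> mA; have [uB tB _] := blkP n; exact: sum_trivIset_le.
exists phi, (kappa ^- 2); split => //.
- by rewrite invr_gt0 exprn_gt0.
- apply: eq_infty => M.
  have [n Mn] : exists n : nat, (M / kappa <= n%:R)%R.
    by exists (Num.truncn (M / kappa)).+1; rewrite ltW// truncnS_gt.
  rewrite (le_trans _ (nneseries_lim_ge (Q n) _))//.
  by rewrite (le_trans _ (sumk n))// lee_fin -ler_pdivrMl// mulrC.
- apply/infinite_set_natP => n; exists (Q n); first exact: leQ.
  rewrite /=.
  (* Group the terms by pairs of blocks, with intersections written so that [le1] fits the inner
     sum. *)
  have -> : \sum_(0 <= s < Q n) \sum_(0 <= t < Q n)
      mu (B (phi s) `&` B (phi t)) =
    \sum_(0 <= k < n) \sum_(0 <= l < n) \sum_(i <- blk k) \sum_(j <- blk l)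
      mu (B j `&` B i).
    rewrite (sum_phi (fun i => \sum_(0 <= t < Q n) mu (B i `&` B (phi t)))).
    apply: eq_bigr => k _; rewrite [RHS]exchange_big /=.
    apply: eq_bigr => i _; rewrite (sum_phi (fun j => mu (B i `&` B j))).
    by apply: eq_bigr => l _; apply: eq_bigr => j _; rewrite setIC.
  apply: (@le_trans _ _ (n%:R * n%:R)%:E).
    have -> : (n%:R * n%:R)%:E = \sum_(0 <= k < n) \sum_(0 <= l < n) (1 : R)%:E.
      under eq_bigr do rewrite sumEFin sumr_const_nat subn0.
      by rewrite sumEFin sumr_const_nat subn0 mulr_natr.
    apply: lee_sum => k _; apply: lee_sum => l _.
    (* Each pair contributes at most 1: disjointness within [blk l] bounds the inner sum by
       [mu (B i)], and disjointness within [blk k] bounds the sum of these by the total mass. *)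
    apply: (@le_trans _ _ (\sum_(i <- blk k) mu (B i))).
      by apply: lee_sum => i _; exact: le1.
    rewrite -(@probability_setT _ _ _ mu) (le_trans _ (le1 _ k _))//.
    by apply: lee_sum => i _; rewrite setIT.
  have := sumk n; set X := \sum_(0 <= s < Q n) _.
  have Xfin : X \is a fin_num.
    by apply/sum_fin_numP => i _ _; rewrite fin_num_measure.
  rewrite -(fineK Xfin) -!EFinM !lee_fin => kn.
  rewrite [leRHS]mulrC ler_pdivlMr ?exprn_gt0// -!expr2
     -exprMn [(n%:R * _)%R]mulrC.
  by rewrite ler_sqr ?nnegrE ?mulr_ge0 ?(ltW k0)//
    (le_trans _ kn)// mulr_ge0 ?(ltW k0).
Qed.

(** * Balls and the doubling property *)

Section metric.
Context {R : realType} {d : measure_display} {T : metricMeasurableType R d}.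

Lemma ball_open_metric (x : T) (r : R) : open (ball x r).
Proof.
rewrite openE => y; rewrite ballEmdist /= => xy; apply/nbhs_ballP.
exists (r - mdist x y)%R; first by rewrite /= subr_gt0.
move=> z; rewrite !ballEmdist /= => yz.
by rewrite (le_lt_trans (metric_triangle _ y _))// addrC -ltrBrDr.
Qed.

Lemma metric_ball_measurable (borelT : borel_in_measurable T) (x : T) (r : R) :
  measurable (ball x r : set T).
Proof.
apply: borelT; apply: sub_sigma_algebra. exact: ball_open_metric.
Qed.

Lemma doubling_iter (mu : probability T R) (S : set T) (lambda r0 : R) :
  (1 <= lambda)%R ->
  (forall (x : T) (r : R), S x -> (0 < r < r0)%R ->
    mu (ball x (2 * r)%R) <= lambda%:E * mu (ball x r)) ->
  forall (n : nat) (x : T) (r : R), S x -> (0 < r)%R -> (2 ^+ n * r < r0)%R ->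
    mu (ball x (2 ^+ n * r)%R) <= (lambda ^+ n)%:E * mu (ball x r).
Proof.
move=> l1 dbl n x r Sx r0'; elim: n => [|n IH] lt.
  by rewrite !expr0 !mul1r mul1e.
have p2 : (0 < 2 ^+ n * r)%R by rewrite mulr_gt0 ?exprn_gt0.
have lt' : (2 ^+ n * r < r0)%R.
  by apply: le_lt_trans lt; rewrite exprS -mulrA; lra.
rewrite exprS -mulrA; apply: (le_trans (dbl _ _ Sx _)); first by rewrite p2 lt'.
rewrite exprS EFinM -muleA lee_wpmul2l ?lee_fin ?(le_trans ler01)//.
exact: IH.
Qed.

(** The centre [x] may lie off the support, so doubling is applied at [y]: [B(x,3r)] lies in
    [B(y,4r)], hence in [B(y,2^n(a-1)r)]; [n] doublings lead down to [B(y,(a-1)r)], which lies in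
    [B(x,ar)]. This gives [K = lambda^n b], and [rho] keeps all radii below [r0]. *)
Lemma triple_ball_doubling (borelT : borel_in_measurable T)
    (mu : probability T R) (S : set T) (lambda r0 a b : R) :
  (1 <= lambda)%R -> (0 < r0)%R ->
  (forall (x : T) (r : R), S x -> (0 < r < r0)%R ->
    mu (ball x (2 * r)%R) <= lambda%:E * mu (ball x r)) ->
  (1 < a)%R -> (1 < b)%R ->
  exists K rho : R, [/\ (0 < K)%R, (0 < rho)%R &
    forall (x y : T) (r : R), S y -> ball x r y -> (0 < r < rho)%R ->
      mu (ball x (a * r)%R) <= b%:E * mu (ball x r) ->
      mu (ball x (3 * r)%R) <= K%:E * mu (ball x r)].
Proof.
move=> l1 r00 dbl a1 b1.
have mball x r := metric_ball_measurable borelT x r.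
have a0 : (0 < a - 1)%R by rewrite subr_gt0.
have [n an] : exists n, (4 / (a - 1) <= 2 ^+ n)%R.
  exists (Num.bound (4 / (a - 1))); rewrite ltW//.
  exact: upper_nthrootP.
rewrite ler_pdivrMr// in an.
have p2 : (0 < 2 ^+ n :> R)%R by rewrite exprn_gt0.
have ln0 : (0 < lambda ^+ n)%R by rewrite exprn_gt0// (lt_le_trans ltr01).
exists (lambda ^+ n * b)%R, (r0 / (2 ^+ n * (a - 1)))%R; split.
- by rewrite mulr_gt0// (lt_trans ltr01).
- by rewrite divr_gt0// mulr_gt0.
move=> x y r Sy xy /andP[r_gt0 rlt] ab.
rewrite ltr_pdivlMr ?mulr_gt0// in rlt.
rewrite ballEmdist /= in xy.
apply: (@le_trans _ _ (mu (ball y (2 ^+ n * ((a - 1) * r))%R))).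
  apply: le_measure; rewrite ?inE// => z; rewrite !ballEmdist /= => xz.
  rewrite (le_lt_trans (metric_triangle _ x _))// metric_sym.
  apply: (@lt_le_trans _ _ (4 * r)%R); first by lra.
  by rewrite mulrA ler_pM2r.
apply: (le_trans (doubling_iter mu S lambda r0 l1 dbl n y ((a - 1) * r)%R Sy _ _)).
- by rewrite mulr_gt0.
- by rewrite mulrA mulrC.
rewrite EFinM -muleA lee_wpmul2l ?lee_fin ?(ltW ln0)//.
apply: le_trans ab; apply: le_measure; rewrite ?inE// => z.
rewrite !ballEmdist /= => yz.
by rewrite (le_lt_trans (metric_triangle _ y _))//; lra.
Qed.

End metric.

(** * Disjoint blocks from a limsup set of positive measure *)

Lemma lim_sup_set_disjoint_blocks (R : realType) (d : measure_display)
    (T : metricMeasurableType R d) (borelT : borel_in_measurable T)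
    (mu : probability T R) (mu_doubling : doubling mu)
    (c : nat -> T) (r : nat -> R) (r_gt0 : forall i, (0 < r i)%R)
    (ab : exists a b : R, [/\ (1 < a)%R, (1 < b)%R &
       \forall i \near \oo,
         mu (ball (c i) (a * r i)%R) <= b%:E * mu (ball (c i) (r i))]) :
  let B := fun i : nat => ball (c i) (r i) in
  0 < mu (lim_sup_set B) ->
  exists2 kappa : R, (0 < kappa)%R &
    forall t, exists s : seq nat, [/\ uniq s, all (leq t) s,
      trivIset [set` s] B & kappa%:E <= \sum_(i <- s) mu (B i)].
Proof.
move=> B E0; have mball x e := metric_ball_measurable borelT x e.
have mB i : measurable (B i) by exact: mball.
have mBU P : measurable (\bigcup_(i in P) B i) by exact: bigcup_measurable.
have [[delta [d0 big]]|small] := pselect (exists delta : R, (0 < delta)%R /\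
    forall t, exists2 i, (t <= i)%N & delta%:E <= mu (B i)).
  exists delta => // t; have [i ti di] := big t.
  exists [:: i]; split; rewrite ?big_seq1//= ?ti//.
  by move=> j k /=; rewrite !inE => /eqP -> /eqP ->.
have {}small (delta : R) : (0 < delta)%R ->
    exists t, forall i, (t <= i)%N -> mu (B i) < delta%:E.
  move=> d0; apply: contrapT => nsm; apply: small; exists delta; split=> // t.
  apply: contrapT => nt; apply: nsm; exists t => i ti.
  by rewrite ltNge; apply/negP => di; apply: nt; exists i.
have [S [clS S1 minS] [lambda [r0 [l1 r00 dbl]]]] := mu_doubling.
have [a [b [a1 b1 [N0 _ abN]]]] := ab.
have [K [rho [K0 rho0 triple]]] :=
  triple_ball_doubling borelT mu _ _ _ _ _ l1 r00 dbl a1 b1.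
have b0 : (0 < b)%R by rewrite (lt_trans ltr01).
have a0 : (0 < a - 1)%R by rewrite subr_gt0.
have mS : measurable S.
  rewrite -(setCK S); apply: measurableC; apply: borelT.
  by apply: sub_sigma_algebra; exact: closed_openC.
(* Otherwise the complement of the ball would be a closed set of full measure missing a point of
   [S]. *)
have ball_supp_gt0 x e : S x -> (0 < e)%R -> 0 < mu (ball x e).
  move=> Sx e0; rewrite lt0e measure_ge0 andbT; apply/eqP => ball0.
  have /(_ x Sx) : S `<=` ~` ball x e; last by apply; exact: ballxx.
  apply: minS; first by apply: open_closedC; exact: ball_open_metric.
  by rewrite probability_setC// ball0 sube0.
pose E := lim_sup_set B.
have mE : measurable E.
  exact: bigcapT_measurable.
have muES : mu (E `&` S) = mu E.
  apply/eqP; rewrite eq_le measureIl//=.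
  rewrite -[X in mu X <= _](setUIDK E S) (le_trans (measureU2 _ _ _))//.
  - exact: measurableI.
  - exact: measurableD.
  rewrite [X in _ + X](_ : _ = 0) ?adde0//; apply/eqP.
  rewrite eq_le measure_ge0 andbT -(subee (x := 1))// -[X in _ - X]S1.
  rewrite -probability_setC//; apply: le_measure; rewrite ?inE//.
  - exact: measurableD.
  - exact: measurableC.
(* If [x] is in [B i] and [r i >= rho], then [B(x,(a-1)rho)] lies in [a B_i], so [mu (B i)] is at
   least the positive number [mu(B(x,(a-1)rho)) / b]; [small] excludes this for large [i]. *)
have covE t : E `&` S `<=` \bigcup_(i in [set i |
    (t <= i)%N /\ (r i < rho)%R /\ B i `&` S !=set0]) B i.
  move=> x [Ex Sx].
  have [M MP] : exists M, forall i, (M <= i)%N ->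
      mu (B i) < (fine (mu (ball x ((a - 1) * rho)%R)) / b)%:E.
    apply: small; rewrite divr_gt0// fine_gt0// ball_supp_gt0 ?mulr_gt0//=.
    by rewrite (le_lt_trans (probability_le1 _ _))// ltry.
  have [i /= + Bix] := Ex (maxn (maxn N0 M) t) I.
  rewrite !geq_max => /andP[/andP[Ni Mi] ti].
  exists i => //; split=> //; split; last by exists x.
  rewrite ltNge; apply/negP => rhoi.
  have := MP i Mi; rewrite ltNge => /negP; apply.
  rewrite -(@lee_pmul2l _ b%:E)// -EFinM mulrC divfK ?gt_eqF//.
  rewrite fineK ?fin_num_measure//; apply: le_trans (abN i Ni).
  apply: le_measure; rewrite ?inE// => z; move: Bix.
  rewrite /B !ballEmdist /= => ix xz.
  rewrite (le_lt_trans (metric_triangle _ x _))//.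
  suff : ((a - 1) * rho <= (a - 1) * r i)%R by lra.
  by rewrite ler_pM2l.
pose e := fine (mu E).
have eE : mu E = e%:E by rewrite fineK// fin_num_measure.
have e0 : (0 < e)%R by rewrite -lte_fin -eE.
(* The factor 2 pays for passing to finitely many balls, and [K] for tripling the radii. *)
exists (e / (2 * K))%R; first by rewrite divr_gt0 ?mulr_gt0.
move=> t.
pose good := [pred i : nat |
  [&& (maxn t N0 <= i)%N, (r i < rho)%R & `[< B i `&` S !=set0 >]]].
pose F n := \bigcup_(i in [set i | (i < n)%N /\ good i]) B i.
have mF n : measurable (F n) by exact: mBU.
have Fcov : E `&` S `<=` \bigcup_n F n.
  move=> x /(covE (maxn t N0))[i [ti [ri Bi]] Bix].
  exists i.+1 => //; exists i => //; split=> //.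
  by rewrite /good /= ti ri; apply/asboolP.
(* Continuity from below: the sets [F n] increase to a union containing a set of measure [e]. *)
have [n en] : exists n, (e / 2)%:E < mu (F n).
  have : mu (F n) @[n --> \oo] --> mu (\bigcup_n F n).
    apply: nondecreasing_cvg_mu => //; first exact: bigcup_measurable.
    move=> k l kl; apply/subsetPset => x [i [ik gi] Bix].
    by exists i => //; split=> //; exact: leq_trans kl.
  move=> Fc; apply: contrapT => nF.
  have : mu (\bigcup_n F n) <= (e / 2)%:E.
    rewrite -(cvg_lim (@ereal_hausdorff _) Fc); apply: lime_le.
      by apply/cvg_ex; exists (mu (\bigcup_n F n)).
    by apply: nearW => k; rewrite leNgt; apply/negP => ?; apply: nF; exists k.
  apply/negP; rewrite -ltNge (@lt_le_trans _ _ (mu (E `&` S)))//.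
    by rewrite muES eE lte_fin; lra.
  apply: le_measure; rewrite ?inE//; first exact: measurableI.
  exact: bigcup_measurable.
have [D [uD Ds tD cD]] :=
  vitali_finite R T _ c r [seq i <- iota 0 n | good i] r_gt0.
have Dgood i : i \in D -> good i by move=> /Ds; rewrite mem_filter => /andP[].
exists D; split=> //.
  by apply/allP => i /Dgood /andP[+ _]; rewrite geq_max => /andP[].
have step1 : mu (F n) <= \sum_(i <- D) mu (ball (c i) (3 * r i)%R).
  rewrite fsbig_seq//; apply: content_sub_fsum => //.
  move=> x [i [ilt gi] Bix].
  have [|j jD ij] := cD i; first by rewrite mem_filter gi mem_iota.
  by exists j => //; exact: ij.
have step2 : \sum_(i <- D) mu (ball (c i) (3 * r i)%R) <=
    K%:E * \sum_(i <- D) mu (B i).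
  rewrite ge0_sume_distrr//.
  rewrite big_seq [leRHS]big_seq; apply: lee_sum => i /Dgood.
  move=> /and3P[+ ri /asboolP[y [Biy Sy]]]; rewrite geq_max => /andP[_ Ni].
  by apply: (triple _ y) => //; [rewrite r_gt0|exact: abN].
rewrite -(@lee_pmul2l _ K%:E)// -EFinM.
rewrite (_ : K * _ = e / 2)%R; last by field; rewrite gt_eqF.
exact: le_trans (ltW en) (le_trans step1 step2).
Qed.

(** * Equivalence of positive measure and quasi-independence on average *)

Theorem theorem3 (R : realType) (d : measure_display)
    (T : metricMeasurableType R d) (borelT : borel_in_measurable T)
    (mu : probability T R) (mu_doubling : doubling mu)
    (c : nat -> T) (r : nat -> R) (r_gt0 : forall i, (0 < r i)%R)
    (ab : exists a b : R, [/\ (1 < a)%R, (1 < b)%R &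
       \forall i \near \oo,
         mu (ball (c i) (a * r i)%R) <= b%:E * mu (ball (c i) (r i))]) :
  let B := fun i : nat => ball (c i) (r i) in
  0 < mu (lim_sup_set B) <->
  exists (phi : nat -> nat) (C : R),
    let L := fun i : nat => B (phi i) in
    [/\ {homo phi : i j / (i < j)%N}, (0 < C)%R,
        \sum_(0 <= i <oo) mu (L i) = +oo &
        infinite_set [set Q : nat |
          \sum_(0 <= s < Q) \sum_(0 <= t < Q) mu (L s `&` L t)
            <= C%:E * (\sum_(0 <= s < Q) mu (L s)) ^+ 2]].
Proof.
move=> B.
have mB i : measurable (B i) by exact: metric_ball_measurable.
split=> [E0|[phi [C [phi_mono C0 Loo quasi]]]].
  have [kappa k0 blocks] :=
    lim_sup_set_disjoint_blocks R d T borelT mu mu_doubling c r r_gt0 ab E0.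
  exact: (quasi_independent_of_disjoint_blocks _ _ _ mu B kappa).
have mBU P : measurable (\bigcup_(i in P) B i) by exact: bigcup_measurable.
have mBphiU P : measurable (\bigcup_(i in P) B (phi i)).
  exact: bigcup_measurable.
(* This places the limsup set of the subsequence inside that of [B]. *)
have phi_ge i : (i <= phi i)%N.
  by elim: i => // i /leq_ltn_trans; apply; exact: phi_mono.
have mL i : measurable (B (phi i)) by [].
have Epos := lim_sup_set_quasi_independent _ _ _ mu _ C mL C0 Loo quasi.
apply: lt_le_trans (le_trans Epos _); first by rewrite lte_fin invr_gt0 mulr_gt0.
apply: le_measure; rewrite ?inE.
- exact: bigcapT_measurable.
- exact: bigcapT_measurable.
move=> x Lx n _; have [j /= nj Ljx] := Lx n I.
by exists (phi j) => //=; exact: leq_trans nj (phi_ge j).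
Qed.
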